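(* Let $f\in\mathcal F$. The following are equivalent: (i) $f$ is faithful; (ii) $f$ is chorus-line conjugate to $r$; (iii) $f=f_g$ for some $g\in\mathcal G$. Moreover, the map $g\mapsto f_g$ is a one-to-one correspondence between $\mathcal G$ and the set of faithful functions in $\mathcal F$.
   Context: For real $x$, $\lfloor x\rfloor$ is the greatest integer $\le x$ and $\{x\}=x-\lfloor x\rfloor$. Let $\mathcal C_i$ be the set of formal infinite integer sequences $[a_0;a_1,a_2,\dots]$ with $a_j\ge1$ for all $j\ge1$, and $\mathcal C_t$ the set of formal finite integer sequences $[a_0;a_1,\dots,a_n]$ ($n\ge0$) with $a_j\ge1$ for $1\le j\le n$ and $a_n\ge2$ if $n\ge1$; put $\mathcal C=\mathcal C_i\cup\mathcal C_t$. Let $\mathcal F$ be the set of strictly decreasing continuous functions $f:(1,\infty)\to(0,1)$ with $\lim_{x\to1^+}f(x)=1$ and $\lim_{x\to+\infty}f(x)=0$, and for $f\in\mathcal F$ let $\phi=f^{-1}$. The expansion function $E_f:\mathbb R\to\mathcal C$: given $x_0$, set $a_0=\lfloor x_0\rfloor$; if $x_k$ is not an integer, set $x_{k+1}=\phi(\{x_k\})$, $a_{k+1}=\lfloor x_{k+1}\rfloor$; if some $x_n$ is an integer (the first such), $E_f(x_0)=[a_0;\dots,a_n]$, otherwise $E_f(x_0)=[a_0;a_1,a_2,\dots]$. The evaluation $V_f$: $V_f([a_0])=a_0$, $V_f([a_0;a_1,\dots,a_n])=a_0+f(V_f([a_1;\dots,a_n]))$, and $V_f([a_0;a_1,a_2,\dots])=\lim_{n\to\infty}V_f([a_0;\dots,a_n])$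 when the limit exists. $f\in\mathcal F$ is faithful if $V_f$ is defined on all of $\mathcal C$ and $E_f:\mathbb R\to\mathcal C$ is a bijection with inverse $V_f$. $r(x)=1/x$ on $(1,\infty)$. Let $\mathcal G$ be the set of increasing homeomorphisms $g:(0,1)\to(0,1)$. For $g\in\mathcal G$, $\bar g:\mathbb R\to\mathbb R$ is $\bar g(x)=x$ if $x\in\mathbb Z$ and $\bar g(x)=\lfloor x\rfloor+g(\{x\})$ otherwise, and $f_g:(1,\infty)\to(0,1)$ is $f_g(x)=g^{-1}(1/\bar g(x))$. A function $h:\mathbb R\to\mathbb R$ is a chorus-line function if $h$ maps $(0,1)$ into itself and $h(x)=\lfloor x\rfloor+h(\{x\})$ for all real $x$. Two functions $f,f'\in\mathcal F$ are chorus-line conjugate if there exists an increasing continuous chorus-line function $h$ (necessarily a homeomorphism of $\mathbb R$) such that $f$ equals the restriction of $h^{-1}\circ f'\circ h$ to $(1,\infty)$. *)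

(* Defs.v *)
From HB Require Import structures.
From mathcomp Require Import all_boot all_order all_algebra.
From mathcomp Require Import all_classical all_reals all_analysis.

Set Implicit Arguments.
Unset Strict Implicit.
Unset Printing Implicit Defensive.

Import Order.TTheory GRing.Theory Num.Theory.
Import numFieldNormedType.Exports.

Local Open Scope classical_set_scope.
Local Open Scope ring_scope.

(* Functions with domain (1, oo) or (0, 1) are represented by total functions
   on R: their values outside the domain are unconstrained and irrelevant, and
   two of them are identified when they agree on the domain. *)

(* [Fin a0 [:: a1; ...; an]] stands for [a0; a1, ..., an], and [Inf a] for
   [a 0; a 1, a 2, ...]. *)
Inductive expansion : Type :=
| Fin of int & seq int
| Inf of nat -> int.

Definition expansions : set expansion := [set c | match c with
  | Fin a0 s => all (fun a : int => 1 <= a) s /\ (s <> [::] -> 2 <= last a0 s)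
  | Inf a => forall j, 1 <= a j.+1
  end].

Section Expansions.
Variable R : realType.
Implicit Types (f g h : R -> R) (x : R).

Definition floorR x : R := (Num.floor x)%:~R.
Definition frac x : R := x - floorR x.

Definition class_F f : Prop :=
  [/\ set_fun `]1, +oo[ `]0, 1[ f,
      {in `]1, +oo[ &, {homo f : x y /~ x < y}},
      {within `]1, +oo[, continuous f},
      f x @[x --> 1^'+] --> (1 : R) &
      f x @[x --> +oo] --> (0 : R)].

Fixpoint iterate f x0 (k : nat) : R :=
  if k is k'.+1 then pinv (`]1, +oo[ : set R) f (frac (iterate f x0 k')) else x0.

(* [ex_minn] selects the first index at which the iterate is an integer; the
   iterates past that index are never used. *)
Definition expand f x0 : expansion :=
  let a k := Num.floor (iterate f x0 k) in
  match pselect (exists n, iterate f x0 n \is a Num.int) with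
  | left ex_int => Fin (a 0) [seq a k | k <- iota 1 (ex_minn ex_int)]
  | right _ => Inf a
  end.

(* [f] extended by continuity at 1. A truncation [a_0; ...; a_n] of an infinite
   expansion may have a_n = 1, in which case its evaluation requires f(1);
   with f(1) = 1 it equals that of [a_0; ...; a_(n-1) + 1]. *)
Definition ext1 f x : R := if x == 1 then 1 else f x.

Fixpoint eval_fin f (a0 : int) (s : seq int) : R :=
  if s is a1 :: s' then a0%:~R + ext1 f (eval_fin f a1 s') else a0%:~R.

Definition truncation_value f (a : nat -> int) (n : nat) : R :=
  eval_fin f (a 0) [seq a k | k <- iota 1 n].

Definition eval_defined f (c : expansion) : Prop :=
  if c is Inf a then cvgn (truncation_value f a) else True.

Definition eval f (c : expansion) : R :=
  match c with
  | Fin a0 s => eval_fin f a0 s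
  | Inf a => limn (truncation_value f a)
  end.

Definition faithful f : Prop :=
  [/\ forall c, expansions c -> eval_defined f c,
      set_bij [set: R] expansions (expand f),
      forall x, eval f (expand f x) = x &
      forall c, expansions c -> expand f (eval f c) = c].

Definition recip x : R := 1 / x.

Definition class_G g : Prop :=
  [/\ set_bij `]0, 1[ `]0, 1[ g,
      {in `]0, 1[ &, {homo g : x y / x < y}},
      {within `]0, 1[, continuous g} &
      {within `]0, 1[, continuous (pinv (`]0, 1[ : set R) g)}].

Definition bar g x : R :=
  if x \is a Num.int then x else floorR x + g (frac x).

Definition f_of g x : R := pinv (`]0, 1[ : set R) g (1 / bar g x).

Definition chorus_line h : Prop :=
  set_fun `]0, 1[ `]0, 1[ h /\ forall x, h x = floorR x + h (frac x).

Definition chorus_line_conjugate f f' : Prop :=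
  exists h, [/\ chorus_line h, {homo h : x y / x < y}, continuous h &
    {in `]1, +oo[, f =1 pinv [set: R] h \o f' \o h}].

End Expansions.

Arguments recip {R} x.

(* Main.v *)
(* The function V_r o E_f compares the f-expansion with the regular continued
   fraction expansion.  When f is faithful it is a bijection that commutes with
   the two expansion algorithms, and it is increasing: a pair reversed by it
   stays reversed (with the roles exchanged) along the algorithm, so that its
   two members have the same expansion.  Hence it is a chorus-line function
   conjugating f to r.  Conversely, a conjugacy h satisfies E_f = E_r o h and
   h o V_f = V_r, which transports faithfulness from r to f; and a chorus-line
   homeomorphism conjugating f to r is bar g for its restriction g to (0,1).
   The map g |-> f_g is injective because bar g = V_r o E_(f_g).
   That r is faithful rests on t |-> 1/(a + 1/(b + t)) being a contraction of
   ratio 1/4. *)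

Require Import Defs.
From HB Require Import structures.
From mathcomp Require Import all_boot all_order all_algebra.
From mathcomp Require Import all_classical all_reals all_analysis.
From mathcomp Require Import ring lra.

Set Implicit Arguments.
Unset Strict Implicit.
Unset Printing Implicit Defensive.

Import Order.TTheory GRing.Theory Num.Theory.
Import numFieldNormedType.Exports.
(* [fraction.frac] and others shadow the names of Defs. *)
Import Defs.

Local Open Scope classical_set_scope.
Local Open Scope ring_scope.

(** * Monotone surjections between intervals *)

Section MonotoneOnto.
Variable R : realType.
Implicit Types (f g h : R -> R) (x y t : R).

(* For monotone maps of intervals, surjectivity amounts to continuity together
   with the right limits at the end points. *)
Definition decreasing_onto f : Prop :=
  [/\ forall x, 1 < x -> 0 < f x < 1,
      forall x y, 1 < x -> x < y -> f y < f x &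
      forall t, 0 < t < 1 -> exists2 x, 1 < x & f x = t].

Definition increasing_onto g : Prop :=
  [/\ forall x, 0 < x < 1 -> 0 < g x < 1,
      forall x y, 0 < x -> x < y -> y < 1 -> g x < g y &
      forall t, 0 < t < 1 -> exists2 x, 0 < x < 1 & g x = t].

(** The values [h x - m] and [h x + m] are attained at points of [A] on either side of [x], and
    monotonicity traps [h] between them on the interval that these points bound. *)
Lemma increasing_onto_continuous_at h (A B : set R) x :
  open A -> open B -> set_surj A B h -> A x -> B (h x) ->
  {in A &, {homo h : y z / y < z}} -> {for x, continuous h}.
Proof.
move=> oA oB hs Ax Bhx hm.
have hcan y z : A y -> A z -> h y < h z -> y < z.
  move=> Ay Az yz; rewrite ltNge; apply/negP; rewrite le_eqVlt => /orP[/eqP zy|zy].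
    by rewrite zy ltxx in yz.
  by have := lt_trans yz (hm _ _ (mem_set Az) (mem_set Ay) zy); rewrite ltxx.
apply/(@cvgrPdist_lt _ R^o) => e e0.
have /nbhs_ballP[d /= d0 dB] : nbhs (h x) B by exact: open_nbhs_nbhs.
(* Halving makes [m] strictly smaller than [e] and than the radius [d], so that [h x - m] and
   [h x + m] stay in [B]. *)
pose m := Num.min d e / 2.
have dep : 0 < Num.min d e by rewrite lt_min d0 e0.
have m0 : 0 < m by rewrite divr_gt0.
have md : m < d.
  by apply: (@lt_le_trans _ _ (Num.min d e)); rewrite ?ge_min ?lexx// /m; lra.
have me : m < e.
  apply: (@lt_le_trans _ _ (Num.min d e)); last by rewrite ge_min lexx orbT.
  by rewrite /m; lra.
have [y1 Ay1 hy1] : exists2 y, A y & h y = h x - m.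
  have [|y Ay <-] := hs (h x - m); last by exists y.
  by apply: dB; rewrite -ball_normE /= (_ : h x - (h x - m) = m) ?gtr0_norm//; ring.
have [y2 Ay2 hy2] : exists2 y, A y & h y = h x + m.
  have [|y Ay <-] := hs (h x + m); last by exists y.
  by apply: dB; rewrite -ball_normE /= (_ : h x - (h x + m) = - m)
    ?normrN ?gtr0_norm//; ring.
have y1x : y1 < x by apply: hcan => //; rewrite hy1; lra.
have xy2 : x < y2 by apply: hcan => //; rewrite hy2; lra.
have nA : nbhs x A by exact: open_nbhs_nbhs.
have nI : nbhs x [set` `]y1, y2[] by apply: near_in_itvoo; rewrite in_itv /= y1x.
near=> y.
have Ay : A y by near: y.
have : [set` `]y1, y2[] y by near: y.
rewrite /= in_itv /= => /andP[y1y yy2].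
have := hm _ _ (mem_set Ay1) (mem_set Ay) y1y.
have := hm _ _ (mem_set Ay) (mem_set Ay2) yy2.
by rewrite hy1 hy2 ltr_norml => *; apply/andP; split; lra.
Unshelve. all: by end_near. Qed.

(** * Comparison with the classes F and G *)

Lemma class_F_decreasing_onto f : class_F f -> decreasing_onto f.
Proof.
move=> [fm fd fc f1 f0].
have fd' x y : 1 < x -> x < y -> f y < f x.
  move=> x1 xy; apply: fd => //; rewrite in_itv /= andbT //.
  exact: lt_trans xy.
split => //.
  by move=> x x1; have := fm x; rewrite /= !in_itv /= andbT => /(_ x1).
move=> t /andP[t0 t1].
have [a a1 fa] : exists2 a, 1 < a & t < f a.
  have : \forall a \near 1^'+, 1 < a /\ t < f a.
    near=> a; split; near: a; first exact: nbhs_right_gt.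
    by apply: (cvgr_gt (1 : R)).
  by move=> /filter_ex[a []]; exists a.
have [b b1 fb] : exists2 b, 1 < b & f b < t.
  have : \forall b \near +oo, 1 < b /\ f b < t.
    near=> b; split; near: b; first exact: nbhs_pinfty_gt.
    by apply: (cvgr_lt (0 : R)).
  by move=> /filter_ex[b []]; exists b.
have ab : a < b.
  rewrite ltNge; apply/negP; rewrite le_eqVlt => /orP[/eqP ba|ba].
    by rewrite ba in fb; lra.
  by have := fd' _ _ b1 ba; lra.
have [||c] := @IVT R f a b t (ltW ab).
- apply: continuous_subspaceW fc => x /=; rewrite !in_itv /= andbT => /andP[ax _].
  exact: lt_le_trans ax.
- by rewrite ge_min le_max (ltW fa) (ltW fb) orbT.
by rewrite in_itv /= => /andP[ac _] fct; exists c => //; exact: lt_le_trans ac.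
Unshelve. all: by end_near. Qed.

(** Continuity is obtained for the opposite of [f], which increases onto (-1, 0). For the limits, a
    value close to the limit is attained at some [z], and monotonicity extends the bound to all
    points beyond [z]. *)
Lemma decreasing_onto_class_F f : decreasing_onto f -> class_F f.
Proof.
move=> [fm fd fs].
have oB : open (`]-1, 0[%classic : set R) by exact: interval_open.
have oA : open (`]1, +oo[%classic : set R) by exact: interval_open.
split.
- by move=> x /=; rewrite !in_itv /= andbT => /fm.
- by move=> x y; rewrite !in_itv /= !andbT => _ y1; exact: fd.
- apply/continuous_in_subspaceT => x; rewrite inE /= in_itv /= andbT => x1.
  rewrite (_ : f = \- (\- f)); last by apply/funext => z; rewrite /= opprK.
  apply: (@cvgN _ R^o).
  apply: (@increasing_onto_continuous_at (\- f) _ _ _ oA oB).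
  + move=> t; rewrite /= in_itv /= => /andP[t1 t0].
    have [|z z1 zt] := fs (- t); first by apply/andP; split; lra.
    by exists z; rewrite /= ?in_itv /= ?andbT// zt opprK.
  + by rewrite /= in_itv /= andbT.
  + by have /andP[? ?] := fm _ x1; rewrite /= in_itv /=; apply/andP; split; lra.
  + move=> y z; rewrite !inE /= !in_itv /= !andbT => y1 _ yz.
    by rewrite ltrN2; exact: fd.
- apply/(@cvgrPdist_lt _ R^o) => e e0.
  (* The maximum with [1 / 2] keeps the target value in (0, 1) even when [e] is at least 1. *)
  have [|z z1 zt] := fs (Num.max (1 / 2) (1 - e)).
    by rewrite lt_max gt_max; do !(apply/andP; split) => //; try lra;
      apply/orP; left; lra.
  near=> x.
  have x1 : 1 < x by near: x; exact: nbhs_right_gt.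
  have xz : x < z by near: x; exact: nbhs_right_lt.
  have := fd _ _ x1 xz; rewrite zt gt_max => /andP[_ xe].
  by have /andP[_ fx1] := fm _ x1; rewrite gtr0_norm; lra.
- apply/(@cvgrPdist_lt _ R^o) => e e0.
  have [|z z1 zt] := fs (Num.min (1 / 2) e).
    by rewrite gt_min lt_min e0; do !(apply/andP; split) => //; try lra;
      apply/orP; left; lra.
  near=> x.
  have zx : z < x by near: x; apply: nbhs_pinfty_gt; exact: num_real.
  have x1 := lt_trans z1 zx.
  have := fd _ _ z1 zx; rewrite zt lt_min => /andP[_ xe].
  by have /andP[fx0 _] := fm _ x1; rewrite sub0r normrN gtr0_norm; lra.
Unshelve. all: by end_near. Qed.

(** Common source of the inverses used below: [phi] and the inverse of [g], both on (0, 1), and that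
    of [h] on the whole line. *)
Lemma pinv_itvP (A B : set R) f : {in A &, injective f} -> set_surj A B f ->
  [/\ forall x, A x -> pinv A f (f x) = x,
      forall t, B t -> A (pinv A f t) &
      forall t, B t -> f (pinv A f t) = t].
Proof.
move=> fi fs; split.
- by move=> x Ax; apply: pinvKV => //; exact: mem_set.
- by move=> t Bt; apply: (surjpinv_image_sub fs); exists t.
- by move=> t Bt; apply: surjpK fs _ _; exact: mem_set.
Qed.

Lemma decreasing_onto_pinv f : decreasing_onto f ->
  [/\ forall x, 1 < x -> pinv (`]1, +oo[ : set R) f (f x) = x,
      forall t, 0 < t < 1 -> 1 < pinv (`]1, +oo[ : set R) f t &
      forall t, 0 < t < 1 -> f (pinv (`]1, +oo[ : set R) f t) = t].
Proof.
move=> [fm fd fs].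
have [||A1 A2 A3] := @pinv_itvP `]1, +oo[ `]0, 1[ f.
- move=> x y; rewrite !inE /= !in_itv /= !andbT => x1 y1 fxy.
  by case: (ltgtP x y) => // [/(fd _ _ x1)|/(fd _ _ y1)]; rewrite fxy ltxx.
- move=> t; rewrite /= in_itv /= => /fs[x x1 <-].
  by exists x => //=; rewrite in_itv /= andbT.
split.
- by move=> x x1; apply: A1; rewrite /= in_itv /= andbT.
- by move=> t t1; have := A2 t; rewrite /= !in_itv /= andbT => /(_ t1).
- by move=> t t1; have := A3 t; rewrite /= !in_itv /= => /(_ t1).
Qed.

Lemma increasing_onto_pinv g : increasing_onto g ->
  [/\ forall x, 0 < x < 1 -> pinv (`]0, 1[ : set R) g (g x) = x,
      forall t, 0 < t < 1 -> 0 < pinv (`]0, 1[ : set R) g t < 1 &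
      forall t, 0 < t < 1 -> g (pinv (`]0, 1[ : set R) g t) = t].
Proof.
move=> [gm gd gs].
have [||A1 A2 A3] := @pinv_itvP `]0, 1[ `]0, 1[ g.
- move=> x y; rewrite !inE /= !in_itv /= => /andP[x0 x1] /andP[y0 y1] gxy.
  case: (ltgtP x y) => // [xy|yx].
    by have := gd _ _ x0 xy y1; rewrite gxy ltxx.
  by have := gd _ _ y0 yx x1; rewrite gxy ltxx.
- move=> t; rewrite /= in_itv /= => /gs[x x1 <-].
  by exists x => //=; rewrite in_itv.
split.
- by move=> x x1; apply: A1; rewrite /= in_itv.
- by move=> t t1; have := A2 t; rewrite /= !in_itv /= => /(_ t1).
- by move=> t t1; have := A3 t; rewrite /= !in_itv /= => /(_ t1).
Qed.

Lemma class_G_increasing_onto g : class_G g -> increasing_onto g.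
Proof.
move=> [[gm _ gs] gd _ _]; split.
- by move=> x x1; have := gm x; rewrite /= !in_itv /= => /(_ x1).
- move=> x y x0 xy y1; apply: gd; rewrite // in_itv /= ?x0 ?y1 ?andbT //.
    exact: lt_trans y1.
  exact: lt_trans xy.
- move=> t t1; have [|x] := gs t; first by rewrite /= in_itv.
  by rewrite /= in_itv /=; exists x.
Qed.

Lemma increasing_onto_class_G g : increasing_onto g -> class_G g.
Proof.
move=> gP; have [g1 g2 g3] := increasing_onto_pinv gP.
have [gm gd gs] := gP.
have gi : {in `]0, 1[ &, {homo g : x y / x < y}}.
  move=> x y; rewrite !in_itv /= => /andP[x0 _] /andP[_ y1] xy; exact: gd.
have oA : open (`]0, 1[%classic : set R) by exact: interval_open.
have hi : {in `]0, 1[%classic &, {homo pinv (`]0, 1[ : set R) g : x y / x < y}}.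
  move=> x y; rewrite !inE /= !in_itv /= => x01 y01 xy.
  rewrite ltNge; apply/negP; rewrite le_eqVlt => /orP[/eqP yx|yx].
    by have := congr1 g yx; rewrite !g3 // => yx'; rewrite yx' ltxx in xy.
  have /andP[a0 a1] := g2 _ x01; have /andP[b0 b1] := g2 _ y01.
  by have := gd _ _ b0 yx a1; rewrite !g3 // => /(lt_trans xy); rewrite ltxx.
split => //.
- split.
  + by move=> x; rewrite /= !in_itv /= => /gm.
  + move=> x y; rewrite !inE /= !in_itv /= => x01 y01 gxy.
    by rewrite -(g1 x) // gxy g1.
  + move=> t; rewrite /= in_itv /= => /gs[x x1 <-].
    by exists x => //=; rewrite in_itv.
- apply/continuous_in_subspaceT => x; rewrite inE /= in_itv /= => x01.
  apply: (@increasing_onto_continuous_at g _ _ _ oA oA).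
  + move=> t; rewrite /= in_itv /= => /gs[z z1 <-].
    by exists z => //=; rewrite in_itv.
  + by rewrite /= in_itv.
  + by rewrite /= in_itv /=; exact: gm.
  + by move=> y z; rewrite !inE; exact: gi.
- apply/continuous_in_subspaceT => x; rewrite inE /= in_itv /= => x01.
  apply: (@increasing_onto_continuous_at _ _ _ _ oA oA) => //.
  + move=> t; rewrite /= in_itv /= => t1; exists (g t) => /=.
      by rewrite in_itv /=; exact: gm.
    exact: g1.
  + by rewrite /= in_itv /=; exact: g2.
Qed.

End MonotoneOnto.

(** * Expansions *)

Section Expand.
Variable R : realType.
Implicit Types (f g h : R -> R) (x y t : R).

Lemma intEfrac x : (x \is a Num.int) = (frac x == 0).
Proof. by rewrite intrEfloor /frac /floorR subr_eq0 eq_sym. Qed.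

Lemma frac_itv x : 0 <= frac x < 1.
Proof.
have := floor_itv x; rewrite intrD /frac /floorR => /andP[? ?].
by apply/andP; split; lra.
Qed.

Lemma frac_nint x : x \isn't a Num.int -> 0 < frac x < 1.
Proof. by rewrite intEfrac lt0r => ->; exact: frac_itv. Qed.

Lemma floorR_frac x : floorR x + frac x = x.
Proof. by rewrite /frac addrC subrK. Qed.

Lemma floor_addz (m : int) t : 0 <= t < 1 -> Num.floor (m%:~R + t) = m.
Proof.
by move=> /andP[? ?]; apply: floor_def; rewrite intrD; apply/andP; split; lra.
Qed.

Lemma frac_addz (m : int) t : 0 <= t < 1 -> frac (m%:~R + t) = t.
Proof. by move=> ?; rewrite /frac /floorR floor_addz// addrC addKr. Qed.

Lemma addz_nint (m : int) t : 0 < t < 1 -> m%:~R + t \isn't a Num.int.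
Proof.
move=> /andP[t0 t1]; rewrite intEfrac frac_addz ?gt_eqF//.
by rewrite ltW.
Qed.

Lemma floor_itv01 t : 0 <= t < 1 -> Num.floor t = 0.
Proof. by move=> t01; have := floor_addz 0 t01; rewrite add0r. Qed.

Lemma frac_itv01 t : 0 <= t < 1 -> frac t = t.
Proof. by move=> t01; have := frac_addz 0 t01; rewrite add0r. Qed.

Lemma itv01_nint t : 0 < t < 1 -> t \isn't a Num.int.
Proof. by move=> t01; have := addz_nint 0 t01; rewrite add0r. Qed.

Local Notation phi f := (pinv (`]1, +oo[ : set R) f).

(** * Head and tail of an expansion *)

Definition econs (a : int) (c : expansion) : expansion :=
  match c with
  | Fin b s => Fin a (b :: s)
  | Inf b => Inf (fun k => if k is k'.+1 then b k' else a)
  end.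

Lemma econs_inj a b c d : econs a c = econs b d -> a = b /\ c = d.
Proof.
case: c d => [m s|u] [n t|v] //= [].
  by move=> -> -> ->.
move=> uv; have uvE k := congr1 (fun w : nat -> int => w k) uv.
split; first exact: (uvE 0).
by congr Inf; apply/funext => k; exact: (uvE k.+1).
Qed.

(** [iterate] adds its steps at the outside; peeling off the first one instead allows induction
    along the digits from the head. *)
Lemma iterateS f x k :
  iterate f x k.+1 = iterate f (phi f (frac x)) k.
Proof. by elim: k => //= k ->. Qed.

Lemma expand_int f x :
  x \is a Num.int -> expand f x = Fin (Num.floor x) [::].
Proof.
move=> xi; rewrite /expand; case: pselect => [e|[]]; last by exists 0.
by case: ex_minnP => m _ /(_ 0 xi); rewrite leqn0 => /eqP ->.
Qed.

Lemma expand_nint f x : x \isn't a Num.int ->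
  expand f x = econs (Num.floor x) (expand f (phi f (frac x))).
Proof.
move=> xi; rewrite /expand; case: pselect => [e|ne]; case: pselect => [e'|ne'].
- case: ex_minnP => m mi mm; case: ex_minnP => n ni nm /=.
  (* As [x] is not an integer, its first integer iterate comes exactly one step later than that of
     [phi f (frac x)]. *)
  have mn : m = n.+1.
    apply/eqP; rewrite eqn_leq mm ?iterateS//=.
    case: m mi {mm} => [xi'|m]; first by rewrite xi' in xi.
    by rewrite iterateS => /nm.
  rewrite mn; congr Fin; rewrite [iota 1 n.+1]/= map_cons; congr cons.
  rewrite (iotaDl 1 1 n) -map_comp; apply: eq_map => k.
  by rewrite /= -iterateS.
- exfalso; apply: ne'; move: e => -[] [xi'|m]; first by rewrite xi' in xi.
  by rewrite iterateS => mi; exists m.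
- by case: ne; case: e' => m mi; exists m.+1; rewrite iterateS.
- congr Inf; apply/funext => -[//|k]; by rewrite iterateS.
Qed.

Lemma expand_expansions f x : decreasing_onto f -> expansions (expand f x).
Proof.
move=> /decreasing_onto_pinv[_ phi1 _].
have it1 k : iterate f x k \isn't a Num.int -> 1 < iterate f x k.+1.
  by move=> /frac_nint; exact: phi1.
have fl1 k : iterate f x k \isn't a Num.int -> 1 <= Num.floor (iterate f x k.+1).
  by move=> /it1 /ltW; rewrite floor_ge_int.
rewrite /expand; case: pselect => [e|ne] /=; last first.
  by move=> j; apply: fl1; apply/negP => ji; apply: ne; exists j.
case: ex_minnP => m mi mm.
have nint k : (k < m)%N -> iterate f x k \isn't a Num.int.
  by move=> km; apply/negP => /mm; rewrite leqNgt km.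
split.
  apply/allP => a /mapP[[|k]]; rewrite mem_iota //= ltnS => km ->.
  exact/fl1/nint.
case: m mi mm nint => // m mi _ nint _.
rewrite -[m.+1]addn1 iotaD map_cat /= last_cat /=.
(* The final iterate is an integer and exceeds 1, so the last digit is at least 2. *)
have := it1 m (nint _ (ltnSn m)).
rewrite -{1}(floorK mi) -[1]/(1%:~R) ltr_int /= => h1.
by rewrite -(lerD2r (-1)) -gtz0_ge1 ?subr_gt0.
Qed.

(* Coinduction principle for expansions: [P] is a bisimulation between the two
   algorithms. *)
Lemma expand_bisim f f' (P : R -> R -> Prop) x y :
  (forall x y, P x y -> [/\ Num.floor x = Num.floor y,
     (x \is a Num.int) = (y \is a Num.int) &
     x \isn't a Num.int -> P (phi f (frac x)) (phi f' (frac y))]) ->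
  P x y -> expand f x = expand f' y.
Proof.
move=> Pstep Pxy.
(* [P] passes to the [k]-th iterates as long as no earlier iterate of [x] is an integer. *)
have Pk k : (forall j, (j < k)%N -> iterate f x j \isn't a Num.int) ->
    P (iterate f x k) (iterate f' y k).
  elim: k x y Pxy => [//|k IH] x' y' Pxy' xi; rewrite !iterateS; apply: IH.
    by have [_ _] := Pstep _ _ Pxy'; apply; exact: (xi 0).
  by move=> j jk; rewrite -iterateS; exact: xi.
rewrite /expand; case: pselect => [e|ne]; case: pselect => [e'|ne'].
- case: ex_minnP => m mi mm; case: ex_minnP => n ni nm.
  have Pm k : (k <= m)%N -> P (iterate f x k) (iterate f' y k).
    move=> km; apply: Pk => j jk; apply/negP => /mm.
    by rewrite leqNgt (leq_trans jk).
  have nm' : (n <= m)%N.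
    by apply: nm; have [_ <-] := Pstep _ _ (Pm _ (leqnn m)).
  have -> : n = m.
    apply/eqP; rewrite eqn_leq nm' mm//.
    by have [_ ->] := Pstep _ _ (Pm _ nm').
  congr Fin; first by have [] := Pstep _ _ Pxy.
  apply/eq_in_map => k; rewrite mem_iota add1n ltnS => /andP[_ km].
  by have [] := Pstep _ _ (Pm _ km).
- exfalso; apply: ne'; case: (ex_minnP e) => m mi mm.
  exists m; have [|_ <- //] := Pstep _ _ (Pk m _).
  by move=> j jm; apply/negP => /mm; rewrite leqNgt jm.
- exfalso; apply: (ne); case: e' => m; have [|_ <- _ mi] := Pstep _ _ (Pk m _).
    by move=> j _; apply/negP => ji; apply: ne; exists j.
  by exists m.
- congr Inf; apply/funext => k; have [|//] := Pstep _ _ (Pk k _).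
  by move=> j _; apply/negP => ji; apply: ne; exists j.
Qed.

(** Equality of expansions is itself a bisimulation, since [econs] is injective. *)
Lemma expand_eq_step f f' x y : expand f x = expand f' y ->
  [/\ Num.floor x = Num.floor y,
     (x \is a Num.int) = (y \is a Num.int) &
     x \isn't a Num.int ->
       expand f (phi f (frac x)) = expand f' (phi f' (frac y))].
Proof.
have [xi|xi] := boolP (x \is a Num.int); have [yi|yi] := boolP (y \is a Num.int).
- by rewrite (expand_int f xi) (expand_int f' yi) => -[->].
- by rewrite (expand_int f xi) (expand_nint f' yi); case: expand.
- by rewrite (expand_nint f xi) (expand_int f' yi); case: expand.
- by rewrite (expand_nint f xi) (expand_nint f' yi) => /econs_inj[].
Qed.

Lemma faithfulI f : decreasing_onto f ->
  (forall c, expansions c -> eval_defined f c) ->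
  (forall x, eval f (expand f x) = x) ->
  (forall c, expansions c -> expand f (eval f c) = c) ->
  faithful f.
Proof.
move=> fP fd VE EV; split => //; split.
- by move=> x _ /=; exact: expand_expansions.
- by move=> x y _ _ xy; rewrite -(VE x) xy VE.
- by move=> c cE /=; exists (eval f c) => //; exact: EV.
Qed.

End Expand.

(** * Conjugation by chorus-line functions *)

Section Conjugacy.
Variable R : realType.
Implicit Types (f g h : R -> R) (x y t : R).

Local Notation phi f := (pinv (`]1, +oo[ : set R) f).

Lemma recip_decreasing_onto : decreasing_onto (@recip R).
Proof.
split.
- move=> x x1; rewrite /recip div1r invr_gt0 invf_lt1 ?x1 ?andbT; lra.
- by move=> x y x1 xy; rewrite /recip !div1r ltf_pV2 // posrE; lra.
- move=> t /andP[t0 t1]; exists t^-1; first by rewrite invf_gt1.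
  by rewrite /recip div1r invrK.
Qed.

Lemma pinv_recip t : 0 < t < 1 -> phi (@recip R) t = 1 / t.
Proof.
move=> t01; have /andP[t0 t1] := t01.
have [A1 A2 A3] := decreasing_onto_pinv recip_decreasing_onto.
by rewrite -{2}(A3 t t01) /recip !div1r invrK.
Qed.

(** Working form of conjugacy to [recip], free of [pinv]: surjectivity and [h 0 = 0] replace
    continuity, and [h] has been applied to both sides of the equation. *)
Definition conjugator h f : Prop :=
  [/\ chorus_line h, {homo h : x y / x < y}, (forall y, exists x, h x = y),
      h 0 = 0 & forall x, 1 < x -> h (f x) = 1 / h x].

Lemma chorus_line01 h t : chorus_line h -> 0 < t < 1 -> 0 < h t < 1.
Proof. by move=> [hm _] t01; have := hm t; rewrite /= !in_itv /= => /(_ t01). Qed.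

Lemma chorus_line_addz h (m : int) t :
  chorus_line h -> 0 <= t < 1 -> h (m%:~R + t) = m%:~R + h t.
Proof. by move=> [_ hE] t01; rewrite hE /floorR floor_addz// frac_addz. Qed.

Lemma chorus_line_int h (m : int) : chorus_line h -> h 0 = 0 -> h m%:~R = m%:~R.
Proof.
move=> hc h0; rewrite -[m%:~R]addr0 chorus_line_addz ?h0//.
by rewrite lexx ltr01.
Qed.

Lemma chorus_line_frac01 h x : chorus_line h -> h 0 = 0 -> 0 <= h (frac x) < 1.
Proof.
move=> hc h0; have /andP[] := frac_itv x; rewrite le_eqVlt => /orP[/eqP <- _|t0 t1].
  by rewrite h0 lexx ltr01.
by have /andP[/ltW -> ->] := @chorus_line01 h (frac x) hc (introT andP (conj t0 t1)).
Qed.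

Lemma chorus_line_floor_frac h x : chorus_line h -> h 0 = 0 ->
  [/\ Num.floor (h x) = Num.floor x, frac (h x) = h (frac x) &
      (h x \is a Num.int) = (x \is a Num.int)].
Proof.
move=> hc h0; have f01 := chorus_line_frac01 x hc h0.
have [_ hE] := hc; have fr : frac (h x) = h (frac x).
  by rewrite [h x]hE frac_addz.
split => //; first by rewrite [h x]hE floor_addz.
(* Since [h] maps (0, 1) into itself, a fractional part sent to 0 must be 0. *)
rewrite !intEfrac fr; apply/eqP/eqP => [hx|->//].
apply/eqP; rewrite eq_le; have /andP[-> _] := frac_itv x; rewrite andbT leNgt.
apply/negP => x0.
have := chorus_line01 hc (introT andP (conj x0 (proj2 (andP (frac_itv x))))).
by rewrite hx ltxx.
Qed.

Lemma chorus_line_conjugateP f :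
  chorus_line_conjugate f recip <-> exists h, conjugator h f.
Proof.
split=> [[h [hc hi hco hf]]|[h [hc hi hs h0 hf]]]; last first.
  exists h; split => //.
    move=> x; apply: (@increasing_onto_continuous_at R h _ _ x openT openT) => //.
      by move=> y _; have [z hz] := hs y; exists z.
    by move=> y z _ _; exact: hi.
  have [||A1 A2 A3] := @pinv_itvP R setT setT h.
    move=> x y _ _ hxy.
    by case: (ltgtP x y) => // /hi; rewrite hxy ltxx.
    by move=> y _; have [z hz] := hs y; exists z.
  move=> x; rewrite in_itv /= andbT => x1.
  by rewrite /recip -hf// A1.
(* Since [h 1 = 1 + h 0], a positive [h 0] would push [h] above 1 just left of 1, and a negative one
   would push it below 0 just right of 0. *)
have h0 : h 0 = 0.
  have h1 : h 1 = 1 + h 0.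
    by have := @chorus_line_addz h 1 0 hc; rewrite addr0 => ->//; rewrite lexx ltr01.
  apply/eqP; rewrite eq_le; apply/andP; split.
    rewrite -(lerD2l 1) -h1 addr0 leNgt; apply/negP => h11.
    have : \forall x \near (1 : R)^'-, 0 < x < 1 /\ 1 < h x.
      near=> x; split.
        by apply/andP; split; near: x; [exact: nbhs_left_gt|exact: nbhs_left_lt].
      near: x; apply: (cvgr_gt (h 1)) => //.
      by apply: cvg_at_left_filter; exact: hco.
    move=> /filter_ex[x [/(chorus_line01 hc)/andP[_ hx1]]].
    by move=> /(lt_trans hx1); rewrite ltxx.
  rewrite leNgt; apply/negP => h01.
  have : \forall x \near (0 : R)^'+, 0 < x < 1 /\ h x < 0.
    near=> x; split.
      by apply/andP; split; near: x; [exact: nbhs_right_gt|exact: nbhs_right_lt].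
    near: x; apply: (cvgr_lt (h 0)) => //.
    by apply: cvg_at_right_filter; exact: hco.
  move=> /filter_ex[x [/(chorus_line01 hc)/andP[hx0 _]]].
  by move=> /(lt_trans hx0); rewrite ltxx.
(* Integers are fixed, so the intermediate value theorem between consecutive integers reaches
   [y]. *)
have hs y : exists x, h x = y.
  have [|||x _ hx] := @IVT R h (floorR y) (floorR y + 1) y.
  - by rewrite lerDl.
  - by apply: continuous_subspaceT.
  - have /andP[y1 /ltW y2] := floor_itv y.
    rewrite /floorR -[X in _ + X](_ : 1%:~R = 1)// -intrD !(chorus_line_int _ hc h0).
    by rewrite ge_min le_max y1 y2 orbT.
  by exists x.
exists h; split => // x x1.
have [||A1 A2 A3] := @pinv_itvP R setT setT h.
- by move=> y z _ _ hxy; case: (ltgtP y z) => // /hi; rewrite hxy ltxx.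
- by move=> y _; have [z hz] := hs y; exists z.
by rewrite hf ?in_itv /= ?andbT// A3.
Unshelve. all: by end_near. Qed.

(** * Transport of faithfulness along a conjugator *)

Section Conjugator.
Variables (f h : R -> R).
Hypotheses (fP : decreasing_onto f) (hf : conjugator h f).

Lemma conjugator_pinv t : 0 < t < 1 -> h (phi f t) = 1 / h t.
Proof.
have [_ phi1 fphi] := decreasing_onto_pinv fP; move=> t01.
have [_ _ _ _ hfE] := hf.
by rewrite -{2}(fphi t t01) hfE ?phi1// !div1r invrK.
Qed.

(** The graph of [h] is a bisimulation between the two algorithms. *)
Lemma conjugator_expand x : expand f x = expand recip (h x).
Proof.
have [hc hi hs h0 hfE] := hf.
apply: (@expand_bisim _ _ _ (fun x y => y = h x)) => // {}x _ ->.
have [-> -> ->] := chorus_line_floor_frac x hc h0; split => // /frac_nint x01.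
by rewrite conjugator_pinv // pinv_recip //; exact: chorus_line01.
Qed.

Lemma ext1_itv x : 1 <= x -> 0 < ext1 f x <= 1.
Proof.
rewrite /ext1 le_eqVlt eq_sym; case: eqP => [_ _|_ /= x1]; first by rewrite ltr01 lexx.
by have [fm _ _] := fP; have /andP[-> /ltW ->] := fm _ x1.
Qed.

Lemma eval_fin_ge (a : int) s : all (fun b : int => 1 <= b) s ->
  a%:~R <= eval_fin f a s.
Proof.
elim: s a => [//|b s IH] a /= /andP[b1 sP].
have b1' : 1 <= b%:~R :> R by rewrite ler1z.
have /andP[e0 _] := ext1_itv (le_trans b1' (IH b sP)).
by rewrite lerDl ltW.
Qed.

Lemma conjugator_eval_fin a s : all (fun b : int => 1 <= b) s ->
  h (eval_fin f a s) = eval_fin recip a s.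
Proof.
have [hc hi hs h0 hfE] := hf.
have hz m := chorus_line_int m hc h0.
elim: s a => [|b s IH] a /=; first by [].
move=> /andP[b1 sP]; rewrite -IH//.
have b1' : 1 <= b%:~R :> R by rewrite ler1z.
have := le_trans b1' (eval_fin_ge b sP); move: (eval_fin f b s) => z.
rewrite le_eqVlt => /orP[/eqP <-|z1].
  (* When the tail evaluates to 1, the value of [ext1] at 1 makes both sides the integer [a + 1]. *)
  by rewrite /ext1 eqxx (hz 1) eqxx -(intrD _ a 1) hz.
have hz1 : 1 < h z by have := hi _ _ z1; rewrite (hz 1).
rewrite /ext1 !gt_eqF// /recip -hfE// chorus_line_addz//.
by have [fm _ _] := fP; have /andP[/ltW -> ->] := fm _ z1.
Qed.

(** With [k] the inverse of [h], evaluation for [f] is [k] after evaluation for [recip]; infinite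
    expansions use the continuity of [k]. Both inverse identities then transfer. *)
Lemma conjugator_faithful : faithful (@recip R) -> faithful f.
Proof.
move=> [rd _ rVE rEV]; have [hc hi hs h0 hfE] := hf.
have [k hk] := choice hs.
have hinj x y : h x = h y -> x = y.
  by move=> hxy; case: (ltgtP x y) => // /hi; rewrite hxy ltxx.
have kh x : k (h x) = x by apply: hinj; rewrite hk.
have kc : continuous k.
  move=> x; apply: (@increasing_onto_continuous_at R k _ _ x openT openT) => //.
    by move=> y _; exists (h y).
  move=> y z _ _ yz; rewrite ltNge; apply/negP; rewrite le_eqVlt => /orP[/eqP zy|].
    by rewrite -(hk y) -zy hk ltxx in yz.
  by move=> /hi; rewrite !hk => /(lt_trans yz); rewrite ltxx.
have tv a : expansions (Inf a) ->
    truncation_value f a = k \o truncation_value recip a.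
  move=> aP; apply/funext => n; rewrite /= /truncation_value.
  rewrite -conjugator_eval_fin ?kh//.
  by apply/allP => b /mapP[[|j]]; rewrite mem_iota// => _ ->.
have kl a : expansions (Inf a) ->
    truncation_value f a @ \oo --> k (eval recip (Inf a)).
  move=> aP; rewrite tv//; apply: continuous_cvg; first exact: kc.
  exact: rd aP.
have ev c : expansions c -> eval f c = k (eval recip c).
  case: c => [a s [sP _]|a aP] /=; first by rewrite -conjugator_eval_fin ?kh.
  by apply: cvg_lim; [exact: norm_hausdorff|exact: kl].
apply: faithfulI => //.
- by case=> [//|a aP] /=; apply/cvg_ex; exists (k (eval recip (Inf a))); exact: kl.
- move=> x; rewrite ev; last exact: expand_expansions.
  by rewrite conjugator_expand rVE kh.
- by move=> c cP; rewrite conjugator_expand ev// hk rEV.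
Qed.

End Conjugator.

(** * From faithfulness to a conjugator *)

Lemma faithful_conjugator f : faithful (@recip R) ->
  decreasing_onto f -> faithful f -> exists h, conjugator h f.
Proof.
move=> [_ _ rVE rEV] fP [_ [_ finj fsurj] _ _].
have [phif phi1 fphi] := decreasing_onto_pinv fP; have [fm fd _] := fP.
pose h x : R := eval recip (expand f x); exists h.
have hE x : expand recip (h x) = expand f x.
  by rewrite rEV //; exact: expand_expansions.
(* As [h x] and [x] have the same expansion, their first digits agree; evaluating the common tail
   relates the fractional part of [h x] to the next iterate of [x]. *)
have h_step x : [/\ Num.floor (h x) = Num.floor x,
    (h x \is a Num.int) = (x \is a Num.int) &
    x \isn't a Num.int -> frac (h x) = 1 / h (phi f (frac x))].
  have [-> e st] := expand_eq_step (hE x); split => //.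
  move=> xi; have := st; rewrite e => /(_ xi); rewrite pinv_recip.
    by move=> /(congr1 (@eval R recip)); rewrite rVE -/(h _) => <-; rewrite !div1r invrK.
  by apply: frac_nint; rewrite e.
have hint x : x \is a Num.int -> h x = x.
  move=> xi; have [fl e _] := h_step x.
  by rewrite -e in xi; rewrite -(floorK xi) fl floorK// -e.
have h0 : h 0 = 0 by exact: hint.
have h01 t : 0 < t < 1 -> 0 < h t < 1.
  move=> t01; have [fl e _] := h_step t.
  have tn := itv01_nint t01; rewrite -e in tn; have := frac_nint tn.
  rewrite /frac /floorR fl floor_itv01 ?subr0//.
  by have /andP[/ltW -> ->] := t01.
(* This is [h_step] at [f x], which is its own fractional part and whose next iterate is [x]. *)
have hfE x : 1 < x -> h (f x) = 1 / h x.
  move=> x1; have f01 := fm _ x1.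
  have f01' : 0 <= f x < 1 by have /andP[/ltW -> ->] := f01.
  have [fl e] := h_step (f x); move=> /(_ (itv01_nint f01)).
  rewrite (frac_itv01 f01') phif// => <-.
  by rewrite /frac /floorR fl floor_itv01 ?subr0.
split => //.
- split; first by move=> t; rewrite /= !in_itv /=; exact: h01.
  move=> x; have [xi|xi] := boolP (x \is a Num.int).
    rewrite hint//; have := xi; rewrite intEfrac => /eqP fx; rewrite fx h0 -fx.
    by rewrite floorR_frac.
  have [fl _ /(_ xi) fr] := h_step x.
  have x01 := frac_nint xi; have [fl' _] := h_step (frac x).
  (* [x] and [frac x] have the same next iterate, hence their images under [h] have the same
     fractional part. *)
  move=> /(_ (itv01_nint x01)); rewrite (frac_itv01 (frac_itv x)) -fr => fr'.
  rewrite -[LHS]floorR_frac -[h (frac x)]floorR_frac fr' {1 3}/floorR fl fl'.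
  by rewrite (floor_itv01 (frac_itv x)) add0r.
- have h_gt0 z : 1 < z -> 0 < h z.
    move=> z1; have [fl _ _] := h_step z; apply: lt_le_trans (floor_le (h z)).
    by rewrite fl ltr0z floor_gt0 ltW.
  (* The pairs reversed by [h] form a bisimulation of [expand f] with itself. *)
  pose bad x y := x < y /\ h y <= h x.
  (* The next iterates reverse both orders at once: that of the points because [f] decreases, that
     of their images through reciprocals. *)
  have bad_step x y : bad x y -> [/\ Num.floor x = Num.floor y,
      x \isn't a Num.int, y \isn't a Num.int &
      bad (phi f (frac y)) (phi f (frac x))].
    move=> [xy hyx]; have [flx ex frx] := h_step x; have [fly ey fry] := h_step y.
    have fl : Num.floor x = Num.floor y.
      apply/eqP; rewrite eq_le (le_floor (ltW xy)) /=.
      by have := le_floor hyx; rewrite flx fly.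
    have yi : y \isn't a Num.int.
      apply/negP => /floorK yE; have := floor_le x.
      by rewrite fl yE leNgt xy.
    (* An integer [x] would be fixed by [h] and equal to the floor of [h y]; then [h y <= h x] would
       make [h y], hence [y], an integer. *)
    have xi : x \isn't a Num.int.
      apply/negP => xi; move: (yi); rewrite -ey => /negP; apply.
      rewrite intrEfloor eq_le floor_le fly -fl floorK//=.
      by rewrite -[X in _ <= X](hint _ xi).
    have fx01 := frac_nint xi; have fy01 := frac_nint yi.
    split => //; split.
      rewrite ltNge; apply/negP; rewrite le_eqVlt => /orP[/eqP pxy|pxy].
        have := congr1 f pxy; rewrite !fphi// /frac /floorR fl => /addIr xyE.
        by rewrite xyE ltxx in xy.
      have := fd _ _ (phi1 _ fx01) pxy; rewrite !fphi//.
      by rewrite /frac /floorR fl ltrD2r => /(lt_trans xy); rewrite ltxx.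
    have := hyx; rewrite -(lerD2r (- floorR x)).
    rewrite {1}/floorR fl -{1}fly -/(floorR (h y)) -/(frac (h y)) fry//.
    rewrite {1}/floorR -flx -/(floorR (h x)) -/(frac (h x)) frx//.
    by rewrite !div1r lef_pV2 // posrE h_gt0// phi1.
  move=> x y xy; rewrite ltNge; apply/negP => hyx.
  suff : expand f x = expand f y by move=> /(finj x y) xyE; rewrite xyE ?inE// ltxx in xy.
  (* Both orientations are included because each step exchanges the two members. *)
  apply: (@expand_bisim _ _ _ (fun x y => bad x y \/ bad y x)); last by left.
  move=> {xy hyx}{}x {}y [] /bad_step[-> /negbTE -> /negbTE -> bd];
    split => // _; first [by left|by right].
- move=> y; have [|x _ xy] := fsurj (expand recip y).
    by apply: expand_expansions; exact: recip_decreasing_onto.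
  by exists x; rewrite /h xy rVE.
Qed.

End Conjugacy.

(** * Regular continued fractions *)

Section ContinuedFractions.
Variable R : realType.
Implicit Types (x y s t u v : R) (a : nat -> int) (n m : nat).

Local Notation phi f := (pinv (`]1, +oo[ : set R) f).

Lemma ext1_recip x : ext1 (@recip R) x = 1 / x.
Proof. by rewrite /ext1; case: eqP => [->|//]; rewrite divr1. Qed.

(** * Truncations as functions of their tail term *)

Definition shift a : nat -> int := fun k => a k.+1.

Lemma truncation_valueS (f : R -> R) a n :
  truncation_value f a n.+1 = (a 0)%:~R + ext1 f (truncation_value f (shift a) n).
Proof. by rewrite /truncation_value /= (iotaDl 1 1 n) -map_comp. Qed.

(* [cf_tail a n t] is [a_0; a_1, ..., a_n + t]. *)
Fixpoint cf_tail a n t : R :=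
  (a 0)%:~R + (if n is n'.+1 then 1 / cf_tail (shift a) n' t else t).

Lemma truncation_value_recip a n : truncation_value recip a n = cf_tail a n 0.
Proof.
elim: n a => [|n IH] a; first by rewrite /= addr0.
by rewrite truncation_valueS IH ext1_recip.
Qed.

Lemma cf_tail_ge a n t : expansions (Inf a) -> 0 <= t -> (a 0)%:~R <= cf_tail a n t.
Proof.
elim: n a => [|n IH] a /= aP t0; first by rewrite lerDl.
rewrite lerDl div1r invr_ge0; apply: le_trans (IH (shift a) _ t0).
  by rewrite /shift ler0z; apply: le_trans (aP 0).
by move=> j; exact: (aP j.+1).
Qed.

Lemma cf_tail_shift_ge1 a n t : expansions (Inf a) -> 0 <= t ->
  1 <= cf_tail (shift a) n t.
Proof.
move=> aP t0; apply: le_trans (@cf_tail_ge _ n t _ t0).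
  by rewrite ler1z; exact: aP.
by move=> j; exact: (aP j.+1).
Qed.

Lemma dist_inv_le u v : 1 <= u -> 1 <= v -> `|1 / u - 1 / v| <= `|u - v|.
Proof.
move=> u1 v1.
have -> : 1 / u - 1 / v = (v - u) / (u * v).
  by field; apply/andP; split; rewrite gt_eqF//; lra.
rewrite normrM distrC ler_piMr// normfV invf_le1.
  by rewrite ger0_norm; nra.
by rewrite normr_gt0 gt_eqF//; nra.
Qed.

(** The difference of the two values is [(u - v) / ((b * u + 1) * (b * v + 1))], where each factor
    of the denominator is at least 2. *)
Lemma dist_inv2_le (b : R) u v : 1 <= b -> 1 <= u -> 1 <= v ->
  `|1 / (b + 1 / u) - 1 / (b + 1 / v)| <= `|u - v| / 4.
Proof.
move=> b1 u1 v1.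
have bu : 2 <= b * u + 1 by nra.
have bv : 2 <= b * v + 1 by nra.
have -> : 1 / (b + 1 / u) - 1 / (b + 1 / v) =
    (u - v) / ((b * u + 1) * (b * v + 1)).
  by field; do !(apply/andP; split); rewrite gt_eqF//; lra.
rewrite normrM ler_wpM2l// normfV lef_pV2 ?posrE ?normr_gt0.
- by rewrite ger0_norm; nra.
- by rewrite gt_eqF//; nra.
- by [].
Qed.

(** One level is only non-expanding, while two levels gain 1/4, the square of 1/2. The factor 2
    makes up for the level left over when [n] is odd. *)
Lemma cf_tail_contraction a n s t : expansions (Inf a) -> 0 <= s -> 0 <= t ->
  `|cf_tail a n s - cf_tail a n t| <= 2 * (1 / 2) ^+ n * `|s - t|.
Proof.
move=> + s0 t0; have addlK (c u v : R) : c + u - (c + v) = u - v by ring.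
have st0 := normr_ge0 (s - t).
(* The recursion goes back two levels, so the induction carries two consecutive cases. *)
pose P m := forall a, expansions (Inf a) ->
  `|cf_tail a m s - cf_tail a m t| <= 2 * (1 / 2) ^+ m * `|s - t|.
suff : P n /\ P n.+1 by move=> [+ _]; apply.
elim: n => [|n [IH0 IH1]].
  split=> b bP /=; rewrite !addlK; first by rewrite expr0; lra.
  have b1 : 1 <= (shift b 0)%:~R :> R by rewrite ler1z; exact: bP.
  rewrite expr1; apply: le_trans (dist_inv_le _ _) _; try lra.
  by rewrite addlK; lra.
split => // b bP; rewrite [cf_tail]lock /= -lock /= !addlK.
have b1 : 1 <= (shift b 0)%:~R :> R by rewrite ler1z; exact: bP.
have bP1 : expansions (Inf (shift b)) by move=> j; exact: (bP j.+1).
have bP2 : expansions (Inf (shift (shift b))) by move=> j; exact: (bP j.+2).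
apply: le_trans (dist_inv2_le b1 (cf_tail_shift_ge1 _ bP1 s0)
  (cf_tail_shift_ge1 _ bP1 t0)) _.
have := IH0 _ bP2; rewrite !exprS; set c := _ ^+ n; set z := `|_|; lra.
Qed.

(** Views a longer truncation as a shorter one with another tail term; [b] is [a] with its first
    [n + 1] terms dropped. *)
Lemma cf_tail_add a n m t :
  exists b, cf_tail a (n + m).+1 t = cf_tail a n (1 / cf_tail b m t) /\
    (expansions (Inf a) -> expansions (Inf b) /\ 1 <= b 0%N).
Proof.
elim: n a => [|n IH] a.
  exists (shift a); split => // aP; split; last exact: aP.
  by move=> j; exact: (aP j.+1).
have [b [bE bP]] := IH (shift a); exists b; rewrite addSn.
split.
  rewrite -[LHS]/((a 0)%:~R + 1 / cf_tail (shift a) (n + m).+1 t).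
  by rewrite bE.
by move=> aP; apply: bP => j; exact: (aP j.+1).
Qed.

(** Both truncations are values of [cf_tail a n] at tail terms in [0, 1], so the contraction
    estimate applies. *)
Lemma truncation_dist a n m : expansions (Inf a) ->
  `|truncation_value recip a (n + m) - truncation_value recip a n|
     <= 2 * (1 / 2 : R) ^+ n.
Proof.
move=> aP; rewrite !truncation_value_recip.
have c0 : 0 <= (1 / 2 : R) ^+ n by rewrite exprn_ge0.
case: m => [|m]; first by rewrite addn0 subrr normr0; lra.
have [b [+ /(_ aP)[bP b1]]] := cf_tail_add a n m 0; rewrite addnS => ->.
have z1 : 1 <= cf_tail b m 0 by apply: le_trans (cf_tail_ge m bP (lexx 0)); rewrite ler1z.
have iz0 : 0 <= 1 / cf_tail b m 0 by rewrite div1r invr_ge0; lra.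
have iz1 : 1 / cf_tail b m 0 <= 1 by rewrite div1r invf_le1//; lra.
apply: le_trans (cf_tail_contraction n aP iz0 (lexx 0)) _.
by rewrite subr0 ger0_norm// ler_piMr// mulr_ge0.
Qed.

Lemma near_geometric_lt (e : R) : 0 < e -> \forall n \near \oo, 2 * (1 / 2 : R) ^+ n < e.
Proof.
move=> e0.
have : (fun n => 2 * (1 / 2 : R) ^+ n) @ \oo --> (2 * 0 : R).
  by apply: cvgM; [exact: cvg_cst|apply: cvg_expr; rewrite ger0_norm; lra].
by rewrite mulr0 => /cvgr_lt; exact.
Qed.

Lemma truncation_cvg a : expansions (Inf a) ->
  cvgn (truncation_value (@recip R) a).
Proof.
move=> aP; apply: cauchy_cvg; apply: cauchy_exP => e e0.
have [n ne] := filter_ex (near_geometric_lt e0).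
exists (truncation_value recip a n); exists n => // m /= nm.
rewrite -ball_normE /= distrC; apply: le_lt_trans ne.
by rewrite -{1}(subnKC nm); exact: truncation_dist.
Qed.

(** * Expansion and evaluation for r are mutually inverse *)

Local Arguments eval : simpl never.

(** The recursion on digits passes to the limit because inversion is continuous away from 0. Limits
    of truncations only give a value at least 1; unfolding the recursion once more makes this
    strict. *)
Lemma eval_Inf_recip a : expansions (Inf a) ->
  eval recip (Inf a) = (a 0)%:~R + 1 / eval recip (Inf (shift a)) :> R /\
  1 < eval recip (Inf (shift a)) :> R.
Proof.
have ge1 b : expansions (Inf b) -> 1 <= b 0%N -> 1 <= eval recip (Inf b) :> R.
  move=> bP b1; apply: limr_ge; first exact: truncation_cvg.
  near=> n; rewrite truncation_value_recip.
  by apply: le_trans (cf_tail_ge n bP (lexx 0)); rewrite ler1z.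
have rec b : expansions (Inf b) ->
    eval recip (Inf b) = (b 0)%:~R + 1 / eval recip (Inf (shift b)) :> R.
  move=> bP; have bP1 : expansions (Inf (shift b)) by move=> j; exact: (bP j.+1).
  apply: cvg_lim => //; rewrite -cvg_shiftS.
  rewrite (_ : (fun n => _) =
      fun n => (b 0)%:~R + (truncation_value recip (shift b) n)^-1); last first.
    by apply/funext => n /=; rewrite truncation_valueS ext1_recip div1r.
  apply: cvgD; first exact: cvg_cst.
  rewrite div1r; apply: cvgV; last exact: truncation_cvg.
  by rewrite gt_eqF//; apply: lt_le_trans (ge1 _ bP1 (bP 0)).
move=> aP; have aP1 : expansions (Inf (shift a)) by move=> j; exact: (aP j.+1).
have aP2 : expansions (Inf (shift (shift a))) by move=> j; exact: (aP j.+2).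
split; first exact: rec.
rewrite rec//; have := ge1 _ aP2 (aP 1%N) => h1.
have : 1 <= (shift a 0)%:~R :> R by rewrite ler1z; exact: aP.
have : 0 < 1 / eval recip (Inf (shift (shift a))) :> R by rewrite div1r invr_gt0; lra.
lra.
Unshelve. all: by end_near. Qed.

Lemma recip_step (b : int) y : 1 < y ->
  [/\ b%:~R + 1 / y \isn't a Num.int, Num.floor (b%:~R + 1 / y) = b &
      phi (@recip R) (frac (b%:~R + 1 / y)) = y].
Proof.
move=> y1.
have y01 : 0 < 1 / y < 1.
  by rewrite div1r invr_gt0 invf_lt1 ?y1 ?andbT; lra.
have y01' : 0 <= 1 / y < 1 by have /andP[/ltW -> ->] := y01.
by rewrite addz_nint// floor_addz// frac_addz// pinv_recip// !div1r invrK.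
Qed.

(** The iterates are the values of the shifted sequences, and none is an integer, each being a digit
    plus a number in (0, 1). *)
Lemma expand_eval_Inf_recip a : expansions (Inf a) ->
  expand recip (eval recip (Inf a) : R) = Inf a.
Proof.
pose sh k := iter k shift a.
move=> aP; have shE k j : sh k j = a (k + j)%N.
  by elim: k j => // k IH j; rewrite /sh /= /shift -/(sh k) IH addnS.
have shP k : expansions (Inf (sh k)) by move=> j; rewrite shE addnS; exact: aP.
have st k := eval_Inf_recip (shP k).
have it k : iterate recip (eval recip (Inf a) : R) k = eval recip (Inf (sh k)).
  elim: k => // k /= ->; have [-> gt1] := st k.
  by have [_ _ ->] := recip_step (sh k 0%N) gt1.
rewrite /expand; case: pselect => [e|_].
  exfalso; case: e => k; rewrite it; have [-> gt1] := st k.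
  by have [/negbTE ->] := recip_step (sh k 0%N) gt1.
congr Inf; apply/funext => k; rewrite it; have [-> gt1] := st k.
by have [_ -> _] := recip_step (sh k 0%N) gt1; rewrite shE addn0.
Qed.

Lemma expand_eval_fin_recip (b : int) (s : seq int) : expansions (Fin b s) ->
  expand recip (eval_fin recip b s : R) = Fin b s.
Proof.
elim: s b => [|c s IH] b /= [].
  by rewrite expand_int ?intr_int// intrKfloor.
move=> /andP[c1 sP] sl; have {}sl : 2 <= last c s by apply: sl.
(* The condition on the last digit enters here: a one-digit tail is at least 2, and a longer one
   adds a positive term to a digit at least 1. *)
have z1 : 1 < eval_fin recip c s :> R.
  case: s sP sl {IH} => [|d s] /=; first by rewrite ltr1z => _; exact: lt_le_trans.
  move=> /andP[d1 sP] _; rewrite ext1_recip.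
  have := eval_fin_ge (@recip_decreasing_onto R) d sP => dz.
  have : 1 <= d%:~R :> R by rewrite ler1z.
  have : 1 <= c%:~R :> R by rewrite ler1z.
  have : 0 < 1 / eval_fin recip d s :> R.
    rewrite div1r invr_gt0; apply: lt_le_trans dz; rewrite ltr0z.
    exact: lt_le_trans d1.
  lra.
rewrite ext1_recip; have [ni fl ph] := recip_step b z1.
by rewrite expand_nint// fl ph IH//; split.
Qed.

Lemma expand_recip_nint x : x \isn't a Num.int ->
  expand recip x = econs (Num.floor x) (expand recip (1 / frac x)) /\
  x = floorR x + 1 / (1 / frac x).
Proof.
move=> xi; split; first by rewrite expand_nint// pinv_recip//; exact: frac_nint.
by rewrite !div1r invrK floorR_frac.
Qed.

Lemma eval_expand_fin_recip (b : int) (s : seq int) x :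
  expand recip x = Fin b s -> eval_fin recip b s = x.
Proof.
elim: s b x => [|c s IH] b x; have [xi|xi] := boolP (x \is a Num.int).
- by rewrite expand_int// => -[<-] /=; rewrite floorK.
- by have [-> _] := expand_recip_nint xi; case: expand.
- by rewrite expand_int.
- have [-> xE] := expand_recip_nint xi.
  case E: expand => [d u|//] /= [<- dc us].
  by rewrite dc us in E; rewrite (IH _ _ E) ext1_recip [RHS]xE.
Qed.

(** The tail term is the fractional part of the [n]-th iterate. *)
Lemma expand_Inf_cf_tail a n x : expand recip x = Inf a ->
  exists2 t, 0 <= t <= 1 & x = cf_tail a n t.
Proof.
elim: n a x => [|n IH] a x; have [xi|xi] := boolP (x \is a Num.int).
- by rewrite expand_int.
- have [-> xE] := expand_recip_nint xi; case: expand => // b [<-] /=.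
  exists (frac x); first by have /andP[-> /ltW ->] := frac_itv x.
  by rewrite -[in LHS](floorR_frac x).
- by rewrite expand_int.
- have [-> xE] := expand_recip_nint xi; case E: expand => [//|b] [<-].
  have [t t01 tE] := IH _ _ E; exists t => //=.
  by rewrite [LHS]xE tE.
Qed.

Lemma faithful_recip : faithful (@recip R).
Proof.
have rP := @recip_decreasing_onto R.
apply: faithfulI => //.
- by case=> // a; exact: truncation_cvg.
- move=> x; have := expand_expansions x rP.
  case E: expand => [b s|a] /= aP; first exact: eval_expand_fin_recip.
  apply: cvg_lim => //; apply/(@cvgrPdist_lt _ R^o) => e e0.
  near=> n.
  (* The point and its [n]-th truncation are values of the same [cf_tail a n], at tail terms [t] and
     0. *)
  have [t /andP[t0 t1] ->] := expand_Inf_cf_tail n E.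
  rewrite truncation_value_recip.
  apply: le_lt_trans (cf_tail_contraction n aP t0 (lexx 0)) _.
  rewrite subr0 ger0_norm//; apply: (@le_lt_trans _ _ (2 * (1 / 2 : R) ^+ n)).
    by rewrite ler_piMr// mulr_ge0// exprn_ge0.
  by near: n; exact: near_geometric_lt.
- case=> [b s|a]; first exact: expand_eval_fin_recip.
  exact: expand_eval_Inf_recip.
Unshelve. all: by end_near. Qed.

End ContinuedFractions.

(** * The functions f_g *)

Section ChorusLines.
Variable R : realType.
Implicit Types (f g h : R -> R) (x y t : R).

(** Monotonicity and surjectivity are those of [1 / h x], pulled back through the increasing [h].
    This is how the functions f_g are shown to lie in F. *)
Lemma conjugator_decreasing_onto f h :
  (forall x, 1 < x -> 0 < f x < 1) -> conjugator h f -> decreasing_onto f.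
Proof.
move=> fm [hc hi hs h0 hf].
have h_lt x y : h x < h y -> x < y.
  move=> hxy; rewrite ltNge; apply/negP; rewrite le_eqVlt => /orP[/eqP yx|/hi].
    by rewrite yx ltxx in hxy.
  by move=> /(lt_trans hxy); rewrite ltxx.
have h1 : h 1 = 1 by exact: (chorus_line_int 1 hc h0).
split => //.
  move=> x y x1 xy; have y1 := lt_trans x1 xy; apply: h_lt; rewrite !hf//.
  have hx1 : 1 < h x by rewrite -h1; exact: hi.
  have hxy := hi _ _ xy.
  by rewrite !div1r ltf_pV2 // posrE; lra.
move=> t t01; have /andP[ht0 ht1] := chorus_line01 hc t01.
have [x hx] := hs (1 / h t).
have x1 : 1 < x by apply: h_lt; rewrite hx h1 div1r invf_gt1.
exists x => //; have : h (f x) = h t by rewrite hf// hx !div1r invrK.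
by case: (ltgtP (f x) t) => // /hi + e; rewrite e ltxx.
Qed.

(** A chorus-line function fixing 0 satisfies [bar h = h], so inverting [h] on (0, 1) in the
    conjugacy equation gives exactly the formula for [f_of h]. *)
Lemma conjugator_class_G f h : decreasing_onto f -> conjugator h f ->
  class_G h /\ {in `]1, +oo[, f =1 f_of h}.
Proof.
move=> [fm _ _] [hc hi hs h0 hf].
have hG : increasing_onto h.
  split; first by move=> x; exact: chorus_line01.
    by move=> x y _ xy _; exact: hi.
  move=> t t01; have [x hx] := hs t; exists x => //.
  have [fl fr hint] := chorus_line_floor_frac x hc h0.
  have t01' : 0 <= t < 1 by have /andP[/ltW -> ->] := t01.
  have xi : x \isn't a Num.int by rewrite -hint hx itv01_nint.
  rewrite hx floor_itv01// in fl.
  by rewrite -(floorR_frac x) /floorR -fl add0r; exact: frac_nint.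
split; first exact: increasing_onto_class_G.
have barE x : bar h x = h x.
  rewrite /bar; case: ifPn => [/floorK <-|_]; last by have [_ <-] := hc.
  by rewrite chorus_line_int.
move=> x; rewrite in_itv /= andbT => x1.
have [gK _ _] := increasing_onto_pinv hG.
by rewrite /f_of barE -hf// gK//; exact: fm.
Qed.

(** * The conjugator attached to an element of G *)

Lemma bar_itv01 g t : 0 < t < 1 -> bar g t = g t.
Proof.
move=> t01; have t01' : 0 <= t < 1 by have /andP[/ltW -> ->] := t01.
by rewrite /bar (negbTE (itv01_nint t01)) /floorR floor_itv01// frac_itv01// add0r.
Qed.

Lemma f_of_itv01 g x : increasing_onto g -> 1 < bar g x -> 0 < f_of g x < 1.
Proof.
move=> gP b1; have [_ g2 _] := increasing_onto_pinv gP; apply: g2.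
by rewrite div1r invr_gt0 invf_lt1 ?b1 ?andbT; lra.
Qed.

Lemma bar_chorus_line g : increasing_onto g -> [/\ chorus_line (bar g),
  {homo bar g : x y / x < y}, (forall y, exists x, bar g x = y) & bar g 0 = 0].
Proof.
move=> [gm gi gs].
have b0 : bar g 0 = 0 by rewrite /bar int_num0.
have bc : chorus_line (bar g).
  split; first by move=> t; rewrite /= !in_itv /= => t01; rewrite bar_itv01//; exact: gm.
  move=> x; have [xi|xi] := boolP (x \is a Num.int).
    have := xi; rewrite intEfrac => /eqP fx; rewrite fx b0 -fx floorR_frac.
    by rewrite /bar xi.
  by rewrite {1}/bar (negbTE xi) bar_itv01//; exact: frac_nint.
split => //.
  move=> x y xy; have [_ bE] := bc; rewrite [ltLHS]bE [ltRHS]bE.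
  have /andP[_ bx1] := chorus_line_frac01 x bc b0.
  have /andP[by0 _] := chorus_line_frac01 y bc b0.
  (* Equal floors reduce to comparing fractional parts. Otherwise the floors differ by at least 1,
     which images of fractional parts, lying in [0, 1), cannot offset. *)
  have := le_floor (ltW xy); rewrite le_eqVlt => /orP[/eqP fl|fl].
    have fxy : frac x < frac y by rewrite /frac /floorR fl ltrD2r.
    rewrite /floorR fl ltrD2l.
    have /andP[fx0 fx1] := frac_itv x; have /andP[fy0 fy1] := frac_itv y.
    have fy0' := le_lt_trans fx0 fxy.
    have fy01 : 0 < frac y < 1 by rewrite fy0'.
    move: fx0; rewrite le_eqVlt => /orP[/eqP fx|fx0].
      by rewrite -fx b0; have /andP[] := chorus_line01 bc fy01.
    by rewrite !bar_itv01 ?fx0//; exact: gi.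
  have : floorR x + 1 <= floorR y by rewrite /floorR -(intrD _ _ 1) ler_int lezD1.
  lra.
move=> y; have [yi|yi] := boolP (y \is a Num.int).
  by exists y; rewrite /bar yi.
have [t t01 gt] := gs _ (frac_nint yi); exists (floorR y + t).
rewrite chorus_line_addz ?bar_itv01 ?gt ?floorR_frac//.
by have /andP[/ltW -> ->] := t01.
Qed.

Lemma bar_gt1 g x : increasing_onto g -> 1 < x -> 1 < bar g x.
Proof.
move=> /bar_chorus_line[bc bi _ b0] /bi.
by rewrite (_ : bar g 1 = 1)//; exact: (chorus_line_int 1 bc b0).
Qed.

Lemma bar_conjugator g : increasing_onto g -> conjugator (bar g) (f_of g).
Proof.
move=> gP; have [bc bi bs b0] := bar_chorus_line gP.
split => // x /(bar_gt1 gP) bx1.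
have [_ _ g3] := increasing_onto_pinv gP.
rewrite bar_itv01; last exact: f_of_itv01.
by rewrite /f_of g3// div1r invr_gt0 invf_lt1 ?bx1 ?andbT; lra.
Qed.

Lemma f_of_decreasing_onto g : increasing_onto g -> decreasing_onto (f_of g).
Proof.
move=> gP; apply: (@conjugator_decreasing_onto _ (bar g)); last exact: bar_conjugator.
by move=> x /(bar_gt1 gP); exact: f_of_itv01.
Qed.

Lemma eq_conjugator f f' h : {in `]1, +oo[, f =1 f'} -> conjugator h f' -> conjugator h f.
Proof.
move=> ff' [hc hi hs h0 hf]; split => // x x1.
by rewrite ff' ?hf// in_itv /= x1.
Qed.

Lemma f_of_inj g g' : increasing_onto g -> increasing_onto g' ->
  {in `]1, +oo[, f_of g =1 f_of g'} -> {in `]0, 1[, g =1 g'}.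
Proof.
move=> gP gP' fE t; rewrite in_itv /= => t01.
have fP := f_of_decreasing_onto gP.
(* [bar g] and [bar g'] both conjugate [f_of g] to [recip], so their values at [t] have the same
   regular expansion. *)
have c := conjugator_expand fP (bar_conjugator gP) t.
have c' := conjugator_expand fP (eq_conjugator fE (bar_conjugator gP')) t.
have [_ _ rVE _] := faithful_recip R.
by rewrite -bar_itv01// -[LHS]rVE -c c' rVE bar_itv01.
Qed.

(** Well-definedness of [f_of] on functions identified on (0, 1): the two [pinv] are compared only
    at [1 / bar g x], a point of (0, 1). *)
Lemma eq_f_of g g' : increasing_onto g -> increasing_onto g' ->
  {in `]0, 1[, g =1 g'} -> {in `]1, +oo[, f_of g =1 f_of g'}.
Proof.
move=> gP gP' gE x; rewrite in_itv /= andbT => x1.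
have b1 := bar_gt1 gP x1.
have bE : bar g' x = bar g x.
  rewrite /bar; case: ifPn => // /frac_nint fx01.
  by rewrite gE// in_itv.
have u01 : 0 < 1 / bar g x < 1.
  by rewrite div1r invr_gt0 invf_lt1 ?b1 ?andbT; lra.
have [g1 g2 g3] := increasing_onto_pinv gP.
have [g1' g2' g3'] := increasing_onto_pinv gP'.
by rewrite /f_of bE -{1}(g3' _ u01) -gE ?g1 ?in_itv//= g2'.
Qed.

End ChorusLines.

(** The one-to-one correspondence is split into its last three clauses. Equality of functions
    becomes agreement on the domain, so injectivity comes paired with well-definedness. *)
Theorem theorem11 (R : realType) :
  (forall f : R -> R, class_F f ->
     (faithful f <-> chorus_line_conjugate f recip) /\
     (chorus_line_conjugate f recip <->
        exists2 g : R -> R, class_G g & {in `]1, +oo[, f =1 f_of g})) /\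
  (forall g : R -> R, class_G g -> class_F (f_of g) /\ faithful (f_of g)) /\
  (forall g g' : R -> R, class_G g -> class_G g' ->
     ({in `]1, +oo[, f_of g =1 f_of g'} <-> {in `]0, 1[, g =1 g'})) /\
  (forall f : R -> R, class_F f -> faithful f ->
     exists2 g : R -> R, class_G g & {in `]1, +oo[, f =1 f_of g}).
Proof.
have rF := faithful_recip R.
have conjG (f : R -> R) : class_F f -> (exists h, conjugator h f) ->
    exists2 g : R -> R, class_G g & {in `]1, +oo[, f =1 f_of g}.
  move=> /class_F_decreasing_onto fP [h hf].
  by have [hG fE] := conjugator_class_G fP hf; exists h.
split.
  move=> f fF; have fP := class_F_decreasing_onto fF.
  split; split.
  - by move=> /(faithful_conjugator rF fP) /chorus_line_conjugateP.
  - by move=> /chorus_line_conjugateP[h /(conjugator_faithful fP)]; exact.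
  - by move=> /chorus_line_conjugateP /(conjG f fF).
  - move=> [g /class_G_increasing_onto gP fE]; apply/chorus_line_conjugateP.
    by exists (bar g); exact: eq_conjugator fE (bar_conjugator gP).
split.
  move=> g /class_G_increasing_onto gP; have fP := f_of_decreasing_onto gP.
  split; first exact: decreasing_onto_class_F.
  exact: conjugator_faithful fP (bar_conjugator gP) rF.
split.
  move=> g g' /class_G_increasing_onto gP /class_G_increasing_onto gP'.
  by split; [exact: f_of_inj|exact: eq_f_of].
move=> f fF fF'; apply: conjG => //.
exact: faithful_conjugator rF (class_F_decreasing_onto fF) fF'.
Qed.
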